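(* Let $K=I(X,R)$ be the incidence algebra of a locally finite preordered set $X$ over a $T$-algebra $R$, and suppose that $K$ satisfies Condition (II). Then: 1. $\mathrm{Aut}\,K=\mathrm{In}_1(\mathrm{Aut}\,K)\rtimes\Lambda$; 2. $\mathrm{Ker}\,f=\mathrm{In}_1(\mathrm{Aut}\,K)\rtimes\Psi$; 3. $\Phi=\mathrm{In}(\mathrm{Aut}\,K)\cdot\Psi=\mathrm{In}_1(\mathrm{Aut}\,K)\rtimes\big(\mathrm{In}_0(\mathrm{Aut}\,K)\cdot\Psi\big)$. (All products are internal semidirect products of subgroups of $\mathrm{Aut}\,K$, the left factor being normal.)
   Context: Rings are associative with nonzero identity. $T$ is a commutative ring, $R$ a $T$-algebra, $(X,\le)$ a preordered set (reflexive, transitive relation) which is locally finite: every interval $[x,y]=\{z: x\le z\le y\}$ is finite. Write $x\sim y$ iff $x\le y$ and $y\le x$; $[x]$ is the $\sim$-class of $x$. $K=I(X,R)$ is the $T$-algebra of functions $f:X\times X\to R$ with $f(x,y)=0$ if $x\not\le y$, with pointwise addition and $T$-action and product $(fg)(x,y)=\sum_{x\le z\le y}f(x,z)g(z,y)$. Put $L=\{f\in K: f(x,y)=0 \text{ if } x\not\sim y\}$ (a subalgebra) and $M=\{f\in K: f(x,y)=0\text{ if }x\sim y\}$ (an ideal), so $K=L\oplus M$. For a class $[x]$, the idempotent $e_x\in L$ has $e_x(t,t)=1$ for $t\in[x]$ and all other values $0$. Condition (II): for every $T$-algebra automorphism $\varphi$ of $K$ and every $x\in X$ there is $y\in X$ with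 $\varphi(e_x)\in e_y+M$. Under Condition (II), $\varphi(M)=M$ for every $\varphi\in\mathrm{Aut}\,K$, so $\varphi$ has the form $\varphi(a+b)=\alpha(a)+(\delta(a)+\beta(b))$ ($a\in L,b\in M$) with $T$-linear $\alpha:L\to L$, $\delta:L\to M$, $\beta:M\to M$, where $\alpha\in\mathrm{Aut}\,L$; write $\varphi=\begin{pmatrix}\alpha&0\\ \delta&\beta\end{pmatrix}$. Notation: $\mathrm{Aut}$ is the group of $T$-algebra automorphisms, $\mathrm{In}(\mathrm{Aut}\,\cdot)$ the subgroup of inner automorphisms $a\mapsto v^{-1}av$. $\mathrm{In}_1(\mathrm{Aut}\,K)$ is the subgroup of inner automorphisms defined by elements $1+d$, $d\in M$ (these are always invertible); $\mathrm{In}_0(\mathrm{Aut}\,K)$ is the subgroup of inner automorphisms of $K$ defined by invertible elements of $L$. $f:\mathrm{Aut}\,K\to\mathrm{Aut}\,L$ is the homomorphism $f(\varphi)=\alpha$. $\Lambda$ is the subgroup of diagonal automorphisms ($\delta=0$). $\Psi$ is the subgroup of automorphisms with $\alpha=1$, $\delta=0$. $\Phi=\{\varphi\in\mathrm{Aut}\,K:\ \alpha\in\mathrm{In}(\mathrm{Aut}\,L)\}$.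
   Formalization: The products written with a dot, In(Aut K)·Ψ and In_0(Aut K)·Ψ, are stated as products of subgroups with normal left factor but without trivial intersection, which fails in general (X={1<2}, R=T=ℚ, conjugation by diag(1,2)); those written ⋊ are semidirect. *)

(* Defs.v *)
From HB Require Import structures.
From mathcomp Require Import all_boot all_order all_algebra finmap.
From mathcomp Require Import boolp classical_sets functions cardinality fsbigop.

Set Implicit Arguments.
Unset Strict Implicit.
Unset Printing Implicit Defensive.

Import Order.Theory GRing.Theory.

Local Open Scope classical_set_scope.
Local Open Scope ring_scope.

Section Groups.
Variable G : groupType.
Local Open Scope group_scope.

Definition subgroup (S : set G) :=
  [/\ S 1, forall x y, S x -> S y -> S (x * y) & forall x, S x -> S x^-1].

Definition normal_in (N P : set G) :=
  N `<=` P /\ forall n p, N n -> P p -> N (n ^ p).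

Definition setprod (A B : set G) : set G :=
  [set g | exists a b, [/\ A a, B b & g = a * b]].

Definition product_of (P N H : set G) :=
  [/\ subgroup P, subgroup N, subgroup H, normal_in N P & P = setprod N H].

Definition semidirect_of (P N H : set G) :=
  product_of P N H /\ N `&` H = [set 1].

End Groups.

Section AlgebraAutomorphisms.
Variables (T : comNzRingType) (A : algType T).

Definition is_alg_aut : pred (A -> A) := fun f =>
  `[< [/\ linear f, GRing.monoid_morphism f & bijective f] >].

Record alg_aut := AlgAut { aut_fun :> A -> A; _ : is_alg_aut aut_fun }.

HB.instance Definition _ := [isSub for aut_fun].
HB.instance Definition _ := [Choice of alg_aut by <:].

Implicit Types f g h : alg_aut.

Lemma alg_aut_linear f : linear f.
Proof. by case: f => f /= /asboolP[]. Qed.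

Lemma alg_aut_monoid f : GRing.monoid_morphism f.
Proof. by case: f => f /= /asboolP[]. Qed.

Lemma alg_aut_bij f : bijective f.
Proof. by case: f => f /= /asboolP[]. Qed.

HB.instance Definition _ f :=
  GRing.isLinear.Build T A A *:%R (aut_fun f) (alg_aut_linear f).
HB.instance Definition _ f :=
  GRing.isMonoidMorphism.Build A A (aut_fun f) (alg_aut_monoid f).

Lemma alg_aut_add f : {morph f : x y / x + y}.
Proof. exact: raddfD. Qed.

Lemma alg_aut_mul f : {morph f : x y / x * y}.
Proof. exact: rmorphM. Qed.

Lemma alg_autP f g : f =1 g -> f = g.
Proof. by move=> fg; apply/val_inj/funext. Qed.

Lemma alg_aut1_subproof : is_alg_aut idfun.
Proof. by apply/asboolP; split=> //; exists id. Qed.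

Definition alg_aut1 := AlgAut alg_aut1_subproof.

Lemma alg_autM_subproof f g : is_alg_aut (f \o g).
Proof.
apply/asboolP; split; first by move=> a u v /=; rewrite !linearP.
- by split=> [|x y] /=; rewrite ?rmorph1 ?rmorphM.
- exact: bij_comp (alg_aut_bij f) (alg_aut_bij g).
Qed.

Definition alg_autM f g := AlgAut (alg_autM_subproof f g).

Lemma alg_autV_ex f : {g : A -> A | cancel f g /\ cancel g f}.
Proof. by apply/cid; case: (alg_aut_bij f) => g fK gK; exists g. Qed.

Lemma alg_autV_subproof f : is_alg_aut (sval (alg_autV_ex f)).
Proof.
case: (alg_autV_ex f) => g /= [fK gK]; have fI := can_inj fK.
apply/asboolP; split; last by exists f.
- by move=> a u v; apply: fI; rewrite linearP /= !gK.
- by split=> [|x y]; apply: fI; rewrite ?rmorphM gK ?rmorph1 /= ?gK.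
Qed.

Definition alg_autV f := AlgAut (alg_autV_subproof f).

Lemma alg_autMA : associative alg_autM.
Proof. by move=> f g h; apply: alg_autP. Qed.

Lemma alg_aut1M : left_id alg_aut1 alg_autM.
Proof. by move=> f; apply: alg_autP. Qed.

Lemma alg_autM1 : right_id alg_aut1 alg_autM.
Proof. by move=> f; apply: alg_autP. Qed.

Lemma alg_autVM : left_inverse alg_aut1 alg_autV alg_autM.
Proof.
move=> f; apply: alg_autP => x /=.
by case: (alg_autV_ex f) => g /= [fK gK].
Qed.

Lemma alg_autMV : right_inverse alg_aut1 alg_autV alg_autM.
Proof.
move=> f; apply: alg_autP => x /=.
by case: (alg_autV_ex f) => g /= [fK gK].
Qed.

HB.instance Definition _ := isGroup.Build alg_aut
  alg_autMA alg_aut1M alg_autM1 alg_autVM alg_autMV.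

Lemma alg_autME f g x : (f * g)%g x = f (g x).
Proof. by []. Qed.

Definition invertible (v : A) := exists w, v * w = 1 /\ w * v = 1.

Definition inner_by (v : A) : set alg_aut :=
  [set f | exists w, [/\ v * w = 1, w * v = 1 & forall a, f a = w * a * v]].

Definition inner_aut : set alg_aut :=
  [set f | exists v, inner_by v f].

End AlgebraAutomorphisms.

Arguments inner_aut {T} A.

(* The carrier is required to be nonempty because the incidence algebra over *)
(* the empty set is the zero ring, whereas rings have a nonzero identity.    *)
HB.mixin Record isLocallyFinite (d : Order.disp_t) X of Order.Preorder d X := {
  itv_finite_subproof :
    forall x y : X, finite_set [set z : X | (x <= z)%O && (z <= y)%O];
  locfin_nonempty : exists x : X, True
}.

#[short(type="locfinPreorderType")]
HB.structure Definition LocFinPreorder (d : Order.disp_t) :=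
  { X of Order.Preorder d X & isLocallyFinite d X }.

Definition itv (d : Order.disp_t) (X : locfinPreorderType d) (x y : X) :=
  [set z : X | (x <= z)%O && (z <= y)%O].

Definition eqv (d : Order.disp_t) (X : locfinPreorderType d) (x y : X) :=
  (x <= y)%O && (y <= x)%O.

Section Eqv.
Variables (d : Order.disp_t) (X : locfinPreorderType d).
Implicit Types x y z : X.

Lemma itv_finite x y : finite_set (itv x y).
Proof. exact: itv_finite_subproof. Qed.

Lemma eqvxx x : eqv x x.
Proof. by rewrite /eqv lexx. Qed.

Lemma eqvC x y : eqv x y = eqv y x.
Proof. by rewrite /eqv andbC. Qed.

Lemma eqv_trans x y z : eqv x y -> eqv y z -> eqv x z.
Proof.
by move=> /andP[xy yx] /andP[yz zy]; apply/andP; split;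
  [exact: le_trans xy yz | exact: le_trans zy yx].
Qed.

End Eqv.

Section IncidenceAlgebra.
Variables (T : comNzRingType) (R : algType T).
Variables (d : Order.disp_t) (X : locfinPreorderType d).
Implicit Types x y z t : X.

Definition incident : {pred X -> X -> R} := fun f =>
  `[< forall x y, ~~ (x <= y)%O -> f x y = 0 >].

Lemma incident_submod : submod_closed incident.
Proof.
split; first by apply/asboolP.
move=> a u v /asboolP u0 /asboolP v0; apply/asboolP => x y xy.
by change (a *: u x y + v x y = 0); rewrite u0// v0// scaler0 addr0.
Qed.

HB.instance Definition _ :=
  GRing.isSubmodClosed.Build T (X -> X -> R) incident incident_submod.

Record inc_algebra :=
  IncAlgebra { inc_fun :> X -> X -> R; _ : inc_fun \in incident }.

HB.instance Definition _ := [isSub for inc_fun].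
HB.instance Definition _ := [Choice of inc_algebra by <:].
HB.instance Definition _ :=
  [SubChoice_isSubLmodule of inc_algebra by <:].

Implicit Types f g h : inc_algebra.

Lemma inc_out f x y : ~~ (x <= y)%O -> f x y = 0.
Proof. by case: f => f /= /asboolP; apply. Qed.

Lemma incP f g : (forall x y, f x y = g x y) -> f = g.
Proof. by move=> fg; apply/val_inj/funext => x; apply/funext => y /=. Qed.

Lemma inc0E x y : (0 : inc_algebra) x y = 0. Proof. by []. Qed.
Lemma incDE f g x y : (f + g) x y = f x y + g x y. Proof. by []. Qed.
Lemma incNE f x y : (- f) x y = - f x y. Proof. by []. Qed.
Lemma incBE f g x y : (f - g) x y = f x y - g x y. Proof. by []. Qed.
Lemma incZE a f x y : (a *: f) x y = a *: f x y. Proof. by []. Qed.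

Definition inc1_fun x y : R := (x == y)%:R.

Lemma inc1_subproof : inc1_fun \in incident.
Proof.
apply/asboolP => x y; rewrite /inc1_fun; case: eqVneq => [->|//].
by rewrite lexx.
Qed.

Definition inc1 := IncAlgebra inc1_subproof.

Definition incM_fun f g x y : R := \sum_(z \in itv x y) f x z * g z y.

Lemma incM_subproof f g : incM_fun f g \in incident.
Proof.
apply/asboolP => x y xy; rewrite /incM_fun fsbig1// => z /andP[xz zy].
by rewrite (le_trans xz zy) in xy.
Qed.

Definition incM f g := IncAlgebra (incM_subproof f g).

Let seg x y := fset_set (itv x y).

Let in_seg x y z : (z \in seg x y) = (x <= z)%O && (z <= y)%O.
Proof.
rewrite in_fset_set; last exact: itv_finite.
by apply/idP/idP; rewrite inE.
Qed.

Let incM_seg f g x y : incM f g x y = \sum_(z <- seg x y) f x z * g z y.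
Proof. by rewrite /= /incM_fun fsbig_finite//; exact: itv_finite. Qed.

Let incM_wide f g x y a b : (a <= x)%O -> (y <= b)%O ->
  incM f g x y = \sum_(z <- seg a b) f x z * g z y.
Proof.
move=> ax yb; rewrite incM_seg [RHS](bigID (fun z => z \in seg x y)) /=.
rewrite [X in _ = _ + X]big1 ?addr0; last first.
  move=> z; rewrite in_seg negb_and => /orP[] /inc_out ->;
    by rewrite ?mul0r ?mulr0.
rewrite -[RHS]big_filter; apply: perm_big; apply: uniq_perm; rewrite ?filter_uniq ?fset_uniq//.
move=> z; rewrite mem_filter !in_seg; apply/idP/andP => [|[]//].
by move=> /andP[xz zy]; rewrite xz zy (le_trans ax xz) (le_trans zy yb).
Qed.

Lemma incMA : associative incM.
Proof.
move=> f g h; apply: incP => x y; rewrite !incM_seg.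
transitivity (\sum_(z <- seg x y) \sum_(w <- seg x y) f x z * g z w * h w y).
  rewrite !big_seq; apply: eq_bigr => z; rewrite in_seg => /andP[xz zy].
  rewrite (@incM_wide g h z y x y)// mulr_sumr.
  by apply: eq_bigr => w _; rewrite mulrA.
rewrite exchange_big !big_seq; apply: eq_bigr => z.
rewrite in_seg => /andP[xz zy].
by rewrite (@incM_wide f g x z x y)// mulr_suml.
Qed.

Lemma inc1M : left_id inc1 incM.
Proof.
move=> f; apply: incP => x y; case: (boolP (x <= y)%O) => xy; last first.
  by rewrite !inc_out.
rewrite incM_seg (bigD1_seq x)/= ?fset_uniq// ?in_seg ?lexx//.
rewrite /inc1_fun eqxx mul1r big1 ?addr0// => z zx.
by rewrite eq_sym (negbTE zx) mul0r.
Qed.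

Lemma incM1 : right_id inc1 incM.
Proof.
move=> f; apply: incP => x y; case: (boolP (x <= y)%O) => xy; last first.
  by rewrite !inc_out.
rewrite incM_seg (bigD1_seq y)/= ?fset_uniq// ?in_seg ?lexx ?andbT//.
rewrite /inc1_fun eqxx mulr1 big1 ?addr0// => z zx.
by rewrite (negbTE zx) mulr0.
Qed.

Lemma incMDl : left_distributive incM +%R.
Proof.
move=> f g h; apply: incP => x y; rewrite incDE !incM_seg -big_split/=.
by apply: eq_bigr => z _; rewrite mulrDl.
Qed.

Lemma incMDr : right_distributive incM +%R.
Proof.
move=> f g h; apply: incP => x y; rewrite incDE !incM_seg -big_split/=.
by apply: eq_bigr => z _; rewrite mulrDr.
Qed.

Lemma inc1_neq0 : inc1 != 0.
Proof.
have [x _] := @locfin_nonempty d X; apply/eqP => /(congr1 (fun f => f x x)).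
by rewrite inc0E /= /inc1_fun eqxx; apply/eqP/oner_neq0.
Qed.

HB.instance Definition _ := GRing.Zmodule_isNzRing.Build inc_algebra
  incMA inc1M incM1 incMDl incMDr inc1_neq0.

Lemma inc1E x y : (1 : inc_algebra) x y = (x == y)%:R. Proof. by []. Qed.

Lemma incME f g x y :
  (f * g) x y = \sum_(z \in itv x y) f x z * g z y.
Proof. by []. Qed.

Lemma incZAl a f g : a *: (f * g) = (a *: f) * g.
Proof.
apply: incP => x y; rewrite incZE !incM_seg scaler_sumr.
by apply: eq_bigr => z _; rewrite incZE scalerAl.
Qed.

Lemma incZAr a f g : a *: (f * g) = f * (a *: g).
Proof.
apply: incP => x y; rewrite incZE !incM_seg scaler_sumr.
by apply: eq_bigr => z _; rewrite incZE scalerAr.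
Qed.

HB.instance Definition _ :=
  GRing.Lmodule_isLalgebra.Build T inc_algebra incZAl.
HB.instance Definition _ :=
  GRing.Lalgebra_isAlgebra.Build T inc_algebra incZAr.

(* The subalgebra L. *)
Definition diagonal : {pred inc_algebra} := fun f =>
  `[< forall x y, ~~ eqv x y -> f x y = 0 >].

(* The ideal M. *)
Definition offdiagonal : {pred inc_algebra} := fun f =>
  `[< forall x y, eqv x y -> f x y = 0 >].

Lemma diagonal_subalg : subalg_closed diagonal.
Proof.
split.
- apply/asboolP => x y; rewrite inc1E; case: eqVneq => // ->.
  by rewrite eqvxx.
- move=> a u v /asboolP u0 /asboolP v0; apply/asboolP => x y xy.
  by rewrite incDE incZE u0// v0// scaler0 addr0.
- move=> u v /asboolP u0 /asboolP v0; apply/asboolP => x y xy.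
  rewrite incM_seg big1// => z _; case: (boolP (eqv x z)) => xz.
    rewrite v0 ?mulr0//; apply: contra xy; exact: eqv_trans.
  by rewrite u0// mul0r.
Qed.

HB.instance Definition _ :=
  GRing.isSubalgClosed.Build T inc_algebra diagonal diagonal_subalg.

Lemma offdiagonal_submod : submod_closed offdiagonal.
Proof.
split; first by apply/asboolP.
move=> a u v /asboolP u0 /asboolP v0; apply/asboolP => x y xy.
by rewrite incDE incZE u0// v0// scaler0 addr0.
Qed.

HB.instance Definition _ :=
  GRing.isSubmodClosed.Build T inc_algebra offdiagonal offdiagonal_submod.

Record diag_algebra :=
  DiagAlgebra { diag_val : inc_algebra; _ : diag_val \in diagonal }.

HB.instance Definition _ := [isSub for diag_val].
HB.instance Definition _ := [Choice of diag_algebra by <:].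
HB.instance Definition _ := [SubChoice_isSubNzRing of diag_algebra by <:].
HB.instance Definition _ := [SubZmodule_isSubLmodule of diag_algebra by <:].
HB.instance Definition _ :=
  [SubNzRing_SubLmodule_isSubLalgebra of diag_algebra by <:].
HB.instance Definition _ := [SubLalgebra_isSubAlgebra of diag_algebra by <:].

Record offdiag_module :=
  OffdiagModule { offdiag_val : inc_algebra; _ : offdiag_val \in offdiagonal }.

HB.instance Definition _ := [isSub for offdiag_val].
HB.instance Definition _ := [Choice of offdiag_module by <:].
HB.instance Definition _ :=
  [SubChoice_isSubLmodule of offdiag_module by <:].

Lemma diagP (a : diag_algebra) x y : ~~ eqv x y -> val a x y = 0.
Proof. by case: a => a /= /asboolP; apply. Qed.

Lemma offdiagP (b : offdiag_module) x y : eqv x y -> val b x y = 0.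
Proof. by case: b => b /= /asboolP; apply. Qed.

(* The two projections of the decomposition K = L (+) M. *)
Lemma lpart_inc_subproof f :
  (fun x y => if eqv x y then f x y else 0) \in incident.
Proof. by apply/asboolP => x y xy; rewrite inc_out// if_same. Qed.

Definition lpart_inc f := IncAlgebra (lpart_inc_subproof f).

Lemma lpart_subproof f : lpart_inc f \in diagonal.
Proof. by apply/asboolP => x y /negbTE /= ->. Qed.

Definition lpart f : diag_algebra := DiagAlgebra (lpart_subproof f).

Lemma mpart_subproof f : f - lpart_inc f \in offdiagonal.
Proof. by apply/asboolP => x y xy; rewrite incBE /= xy subrr. Qed.

Definition mpart f : offdiag_module := OffdiagModule (mpart_subproof f).

Lemma lmpartE f : f = val (lpart f) + val (mpart f).
Proof. by rewrite /= addrC subrK. Qed.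

Lemma lpartK : cancel val lpart.
Proof.
move=> a; apply/val_inj/incP => x y /=.
by case: ifPn => // xy; rewrite -[LHS](diagP a xy).
Qed.

Lemma lpart0 (b : offdiag_module) : lpart (val b) = 0.
Proof.
apply/val_inj/incP => x y /=; case: ifP => // xy.
by rewrite [LHS](offdiagP b xy).
Qed.

Lemma lpart_linear : linear lpart.
Proof.
move=> a f g; apply/val_inj/incP => x y.
change ((if eqv x y then (a *: f + g) x y else 0) =
  a *: (if eqv x y then f x y else 0) + (if eqv x y then g x y else 0)).
by case: ifP => // _; rewrite scaler0 addr0.
Qed.

Lemma lpart_monoid : GRing.monoid_morphism lpart.
Proof.
split=> [|f g]; apply/val_inj/incP => x y.
  rewrite /= /inc1_fun; case: ifPn => // xy; case: eqVneq => // xyE.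
  by rewrite xyE eqvxx in xy.
change ((if eqv x y then incM_fun f g x y else 0) =
  incM_fun (lpart_inc f) (lpart_inc g) x y); rewrite /incM_fun /=; case: ifPn => xy; last first.
  rewrite fsbig1// => z _; case: ifPn => xz; last by rewrite mul0r.
  case: ifPn => zy; last by rewrite mulr0.
  by rewrite (eqv_trans xz zy) in xy.
apply: eq_fsbigr => z; rewrite inE => /andP[xz zy].
have /andP[_ yx] := xy.
by rewrite /eqv xz zy (le_trans zy yx) (le_trans yx xz).
Qed.

HB.instance Definition _ :=
  GRing.isLinear.Build T inc_algebra diag_algebra *:%R lpart lpart_linear.
HB.instance Definition _ :=
  GRing.isMonoidMorphism.Build inc_algebra diag_algebra lpart lpart_monoid.

(* The idempotent e_x of the class [x]. *)
Definition class_idem_fun x : X -> X -> R :=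
  fun s t => ((s == t) && eqv x t)%:R.

Lemma class_idem_inc_subproof x : class_idem_fun x \in incident.
Proof.
apply/asboolP => s t; rewrite /class_idem_fun; case: eqVneq => // ->.
by rewrite lexx.
Qed.

Definition class_idem_inc x := IncAlgebra (class_idem_inc_subproof x).

Lemma class_idem_subproof x : class_idem_inc x \in diagonal.
Proof.
apply/asboolP => s t; rewrite /= /class_idem_fun; case: eqVneq => // ->.
by rewrite eqvxx.
Qed.

Definition class_idem x : diag_algebra := DiagAlgebra (class_idem_subproof x).

Definition conditionII :=
  forall (phi : alg_aut inc_algebra) x,
    exists y (m : offdiag_module),
      phi (val (class_idem x)) = val (class_idem y) + val m.

(* The matrix (alpha 0; delta beta) of an automorphism. *)
Definition alpha (phi : alg_aut inc_algebra) (a : diag_algebra) :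
  diag_algebra := lpart (phi (val a)).
Definition delta (phi : alg_aut inc_algebra) (a : diag_algebra) :
  offdiag_module := mpart (phi (val a)).
Definition beta (phi : alg_aut inc_algebra) (b : offdiag_module) :
  offdiag_module := mpart (phi (val b)).

Lemma lpartD f g : lpart (f + g) = lpart f + lpart g.
Proof. exact: raddfD. Qed.

Lemma lpartM f g : lpart (f * g) = lpart f * lpart g.
Proof. exact: rmorphM. Qed.

Lemma lpart_eq0 f : lpart f = 0 -> f = val (mpart f).
Proof. by move=> f0; rewrite [LHS]lmpartE f0 add0r. Qed.

Lemma class_idemMl x f s t :
  (val (class_idem x) * f) s t = if eqv x s then f s t else 0.
Proof.
case: (boolP (s <= t)%O) => st; last by rewrite !inc_out// if_same.
rewrite [LHS]incM_seg (bigD1_seq s)/= ?fset_uniq// ?in_seg ?lexx//.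
rewrite big1 ?addr0 => [|z zs]; last first.
  by rewrite /class_idem_fun eq_sym (negbTE zs) mul0r.
by rewrite /class_idem_fun eqxx; case: ifP; rewrite ?mul1r ?mul0r.
Qed.

Lemma class_idemMr x f s t :
  (f * val (class_idem x)) s t = if eqv x t then f s t else 0.
Proof.
case: (boolP (s <= t)%O) => st; last by rewrite !inc_out// if_same.
rewrite [LHS]incM_seg (bigD1_seq t)/= ?fset_uniq// ?in_seg ?lexx ?andbT//.
rewrite big1 ?addr0 => [|z zs]; last first.
  by rewrite /class_idem_fun (negbTE zs) mulr0.
by rewrite /class_idem_fun eqxx; case: ifP; rewrite ?mulr1 ?mulr0.
Qed.

Lemma class_idem_offdiag x (b : offdiag_module) :
  val (class_idem x) * val b * val (class_idem x) = 0.
Proof.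
apply: incP => s t; rewrite class_idemMr class_idemMl inc0E.
case: ifP => // xt; case: ifP => // xs; rewrite (@offdiagP b)//.
by rewrite eqvC in xs; exact: eqv_trans xs xt.
Qed.

Section ConditionII.
Hypothesis hII : conditionII.
Implicit Types phi : alg_aut inc_algebra.

Lemma alg_autKV phi : cancel (phi^-1)%g phi.
Proof. by move=> a; have /(congr1 (fun u : alg_aut _ => u a)) := mulgV phi. Qed.

Lemma lpart_aut_class_idem phi y :
  exists x, lpart (phi (val (class_idem x))) = class_idem y.
Proof.
have [x [m]] := hII (phi^-1)%g y.
move=> /(congr1 phi); rewrite alg_autKV alg_aut_add => /(congr1 lpart).
have [z [m' phix]] := hII phi x.
have Px : lpart (phi (val (class_idem x))) = class_idem z.
  by rewrite phix lpartD lpartK lpart0 addr0.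
rewrite lpartK lpartD Px => Ey; exists x; rewrite Px.
have Pm : class_idem z * lpart (phi (val m)) * class_idem z = 0.
  by rewrite -Px -!lpartM -!alg_aut_mul class_idem_offdiag !raddf0.
have yz : eqv y z.
  have : class_idem z * class_idem y * class_idem z =
      class_idem z * class_idem z * class_idem z.
    by rewrite Ey mulrDr mulrDl Pm addr0.
  move=> /(congr1 (fun a : diag_algebra => val a z z)).
  rewrite !rmorphM !class_idemMr !eqvxx /= /class_idem_fun.
  rewrite eqxx eqvxx /=; case: (eqv y z) => // /esym/eqP.
  by rewrite (negbTE (oner_neq0 _)).
apply/val_inj/incP => s t; rewrite /= /class_idem_fun; congr ((_ && _)%:R).
by apply/idP/idP; [exact: eqv_trans | apply: eqv_trans; rewrite eqvC].
Qed.

Lemma lpart_aut_offdiag phi (b : offdiag_module) : lpart (phi (val b)) = 0.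
Proof.
apply/val_inj/incP => y t; rewrite inc0E.
case: (boolP (eqv y t)) => yt; last by rewrite diagP.
have [x Px] := lpart_aut_class_idem phi y.
have : class_idem y * lpart (phi (val b)) * class_idem y = 0.
  by rewrite -Px -!lpartM -!alg_aut_mul class_idem_offdiag !raddf0.
move=> /(congr1 (fun a : diag_algebra => val a y t)).
by rewrite !rmorphM class_idemMr class_idemMl eqvxx yt.
Qed.

Lemma aut_matrix phi (a : diag_algebra) (b : offdiag_module) :
  phi (val a + val b) =
  val (alpha phi a) + val (delta phi a + beta phi b).
Proof.
rewrite alg_aut_add [phi (val a)]lmpartE -addrA; congr (_ + _).
rewrite [RHS]raddfD; congr (_ + _).
exact/lpart_eq0/lpart_aut_offdiag.
Qed.

Lemma alphaM phi psi a :
  alpha (phi * psi)%g a = alpha phi (alpha psi a).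
Proof.
rewrite /alpha /= {1}[psi (val a)]lmpartE alg_aut_add lpartD.
by rewrite lpart_aut_offdiag addr0.
Qed.

Lemma alpha1 a : alpha 1%g a = a.
Proof. exact: lpartK. Qed.

Lemma alpha_is_alg_aut phi : is_alg_aut (alpha phi).
Proof.
apply/asboolP; split.
- by move=> c u v; rewrite /alpha !linearP.
- by split=> [|u v]; rewrite /alpha ?rmorphM ?rmorph1.
- by exists (alpha (phi^-1)%g) => a; rewrite -alphaM ?mulVg ?mulgV alpha1.
Qed.

(* The homomorphism f : Aut K -> Aut L. *)
Definition diag_aut phi : alg_aut diag_algebra :=
  AlgAut (alpha_is_alg_aut phi).

Lemma diag_autM phi psi :
  diag_aut (phi * psi)%g = (diag_aut phi * diag_aut psi)%g.
Proof. by apply: alg_autP => a /=; rewrite alphaM. Qed.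

HB.instance Definition _ :=
  isMultiplicative.Build (alg_aut inc_algebra) (alg_aut diag_algebra)
    diag_aut diag_autM.

Definition Ker_diag_aut : set (alg_aut inc_algebra) :=
  [set phi | diag_aut phi = 1%g].

Definition Phi : set (alg_aut inc_algebra) :=
  [set phi | inner_aut diag_algebra (diag_aut phi)].

End ConditionII.

Definition In1 : set (alg_aut inc_algebra) :=
  [set phi | exists m : offdiag_module, inner_by (1 + val m) phi].

Definition In0 : set (alg_aut inc_algebra) :=
  [set phi | exists2 v : diag_algebra, invertible v & inner_by (val v) phi].

Definition Lambda : set (alg_aut inc_algebra) :=
  [set phi | forall a, delta phi a = 0].

Definition Psi : set (alg_aut inc_algebra) :=
  [set phi | (forall a, alpha phi a = a) /\ (forall a, delta phi a = 0)].

End IncidenceAlgebra.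

Arguments inc_algebra {T} R {d} X.
Arguments diag_algebra {T} R {d} X.
Arguments conditionII {T} R {d} X.
Arguments In1 {T} R {d} X.
Arguments In0 {T} R {d} X.
Arguments Lambda {T} R {d} X.
Arguments Psi {T} R {d} X.

(* Main.v *)
(** The idea: by Condition (II) every automorphism phi permutes the idempotents
    e_x modulo M.  The element v of K whose row at s is the row of phi(e_x)
    with phi(e_x) in e_s + M lies in 1 + M, hence is invertible, and satisfies
    v phi(e_x) = alpha(e_x) v.  Conjugating phi by v therefore yields an
    automorphism mapping every e_x to some e_y; such an automorphism maps
    L = prod e_x K e_x to itself, i.e. has delta = 0.  Conversely, conjugation
    by 1 + m preserves L only if m commutes with all e_x, i.e. m = 0. *)

Require Import Defs.
From mathcomp Require Import all_boot all_order all_algebra finmap.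
From mathcomp Require Import boolp classical_sets cardinality fsbigop.

Set Implicit Arguments.
Unset Strict Implicit.
Unset Printing Implicit Defensive.

Import Order.Theory GRing.Theory.

Local Open Scope classical_set_scope.

(** * Internal products of subgroups *)

Section Subgroups.
Variable G : groupType.
Local Open Scope group_scope.
Implicit Types A B N H : set G.

Lemma subgroupI A B : subgroup A -> subgroup B -> subgroup (A `&` B).
Proof.
move=> [A1 AM AV] [B1 BM BV]; split; first by split.
- by move=> x y [Ax Bx] [Ay By]; split; [exact: AM | exact: BM].
- by move=> x [Ax Bx]; split; [exact: AV | exact: BV].
Qed.

(** Invariance of [N] under conjugation by [H] alone suffices, because n h n' h' = n (h n' h^-1) (h
    h') and (n h)^-1 = (h^-1 n^-1 h) h^-1. *)
Lemma setprod_subgroup N H : subgroup N -> subgroup H ->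
  (forall n h, N n -> H h -> N (n ^ h)) -> subgroup (setprod N H).
Proof.
move=> [N1 NM NV] [H1 HM HV] NH; split.
- by exists 1, 1; rewrite mulg1.
- move=> _ _ [n [h [Nn Hh ->]]] [n' [h' [Nn' Hh' ->]]].
  exists (n * n' ^ h^-1), (h * h'); split; last 1 first.
  + by rewrite conjgE invgK !mulgA mulgVK.
  + by apply: NM => //; apply: NH => //; exact: HV.
  + exact: HM.
- move=> _ [n [h [Nn Hh ->]]]; exists (n^-1 ^ h), h^-1; split; last 1 first.
  + by rewrite invgM conjgE !mulgA mulgK.
  + by apply: NH => //; exact: NV.
  + exact: HV.
Qed.

Lemma normal_in_setprod N H : subgroup N -> subgroup H ->
  (forall n h, N n -> H h -> N (n ^ h)) -> normal_in N (setprod N H).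
Proof.
move=> [N1 NM NV] [H1 _ _] NH; split=> [n Nn|n _ Nn [a [h [Na Hh ->]]]].
  by exists n, 1; rewrite mulg1.
rewrite conjgM; apply: NH => //; rewrite conjgE.
exact: NM (NV _ Na) (NM _ _ Nn Na).
Qed.

Lemma setprod_sub A B N : subgroup N ->
  A `<=` N -> B `<=` N -> setprod A B `<=` N.
Proof. by move=> [_ NM _] AN BN _ [a [b [/AN ? /BN ? ->]]]; exact: NM. Qed.

End Subgroups.

Lemma preimage_subgroup (G H : groupType) (f : G -> H) (B : set H) :
  {morph f : x y / (x * y)%g} -> subgroup B -> subgroup (f @^-1` B).
Proof.
move=> fM [B1 BM BV].
have f1 : f 1%g = 1%g by apply: (mulgI (f 1%g)); rewrite -fM !mulg1.
split=> [|x y|x] /=; first by rewrite f1.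
- by rewrite fM; exact: BM.
- have -> : f x^-1%g = (f x)^-1%g.
    by apply: (mulgI (f x)); rewrite -fM !mulgV.
  exact: BV.
Qed.

(** * Inner automorphisms of an algebra *)

Section InnerAutomorphisms.
Variables (T : comNzRingType) (A : algType T).
Local Open Scope ring_scope.
Implicit Types (f g : alg_aut A) (u v w : A).

Lemma alg_autK f : cancel f (f^-1)%g.
Proof. by move=> a; have /(congr1 (fun u : alg_aut _ => u a)) := mulVg f. Qed.

Lemma alg_autVK f : cancel (f^-1)%g f.
Proof. by move=> a; have /(congr1 (fun u : alg_aut _ => u a)) := mulgV f. Qed.

Lemma inner_by_exists v : invertible v -> exists f, inner_by v f.
Proof.
move=> [w [vw wv]].
have aut : is_alg_aut (fun a => w * a * v).
  apply/asboolP; split.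
  - by move=> c a b; rewrite mulrDr mulrDl -scalerAr -scalerAl.
  - split=> [|a b]; first by rewrite mulr1.
    by rewrite !mulrA -[w * a * v * w]mulrA vw mulr1.
  - exists (fun a => v * a * w) => a.
      by rewrite !mulrA vw mul1r -mulrA vw mulr1.
    by rewrite !mulrA wv mul1r -mulrA wv mulr1.
by exists (AlgAut aut), w.
Qed.

Lemma inner_by1 : inner_by (1 : A) 1%g.
Proof. by exists 1; split=> [||a]; rewrite !mulr1 ?mul1r. Qed.

Lemma inner_by1_eq f : inner_by (1 : A) f -> f = 1%g.
Proof.
move=> [w [+ _ fE]]; rewrite mul1r => w1.
by apply: alg_autP => a; rewrite fE w1 mulr1 mul1r.
Qed.

(** The order of the factors is reversed: the group law is composition, while [inner_by v] is
    conjugation a |-> v^-1 a v. *)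
Lemma inner_byM u v f g : inner_by u f -> inner_by v g ->
  inner_by (v * u) (f * g)%g.
Proof.
move=> [u' [uu' u'u fE]] [v' [vv' v'v gE]]; exists (u' * v'); split.
- by rewrite -mulrA [u * _]mulrA uu' mul1r.
- by rewrite -mulrA [v' * _]mulrA v'v mul1r.
- by move=> a; rewrite alg_autME gE fE !mulrA.
Qed.

Lemma inner_byV v w f : v * w = 1 -> w * v = 1 -> inner_by v f ->
  inner_by w (f^-1)%g.
Proof.
move=> vw wv [w' [vw' w'v fE]]; exists v; split=> // a.
rewrite -[in RHS](alg_autVK f a) fE.
by rewrite !mulrA vw' mul1r -mulrA vw mulr1.
Qed.

Lemma inner_byJ v f g : inner_by v f -> inner_by ((g^-1)%g v) (f ^ g)%g.
Proof.
move=> [w [vw wv fE]]; exists ((g^-1)%g w).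
split=> [||a]; rewrite -?alg_aut_mul ?vw ?wv ?rmorph1 //.
by rewrite conjgE !alg_autME fE 2!alg_aut_mul alg_autK.
Qed.

Lemma inner_byVl v f a : inner_by v f -> v * f a = a * v.
Proof. by move=> [w [vw _ fE]]; rewrite fE !mulrA vw mul1r. Qed.

Lemma inner_aut_subgroup : subgroup (inner_aut A).
Proof.
split.
- by exists 1; exact: inner_by1.
- by move=> f g [u uf] [v vg]; exists (v * u); exact: inner_byM.
- move=> f [v vf]; have [w [vw wv _]] := vf; exists w.
  exact: inner_byV vf.
Qed.

Lemma inner_autJ f g : inner_aut A f -> inner_aut A (f ^ g)%g.
Proof. by move=> [v vf]; exists ((g^-1)%g v); exact: inner_byJ. Qed.

End InnerAutomorphisms.

Section IncidenceAlgebra.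
Variables (T : comNzRingType) (R : algType T).
Variables (d : Order.disp_t) (X : locfinPreorderType d).
Local Open Scope ring_scope.
Local Notation K := (inc_algebra R X).
Local Notation L := (diag_algebra R X).
Local Notation M := (offdiag_module R X).
Local Notation e := (@class_idem T R d X).
Implicit Types (f g : K) (m : M) (a : L) (x y z s t : X).

(** * Interval lengths and invertibility of 1 + M *)

Definition itv_size x y : nat := #|` fset_set (itv x y)|%fset.

Lemma itv_size_lel x y z : (x <= z)%O -> (itv_size z y <= itv_size x y)%N.
Proof.
move=> xz; apply: fsubset_leq_card; rewrite -fset_set_sub;
  try exact: itv_finite.
by move=> t /andP[zt ty]; rewrite /itv /= (le_trans xz zt).
Qed.

Lemma itv_size_ler x y z : (z <= y)%O -> (itv_size x z <= itv_size x y)%N.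
Proof.
move=> zy; apply: fsubset_leq_card; rewrite -fset_set_sub;
  try exact: itv_finite.
by move=> t /andP[xt tz]; rewrite /itv /= xt (le_trans tz zy).
Qed.

(** The point [x] itself lies in [x, y] but not in [z, y], so a strict step up shortens the
    interval. *)
Lemma itv_size_lt x y z : (x <= z)%O -> (z <= y)%O -> ~~ (z <= x)%O ->
  (itv_size z y < itv_size x y)%N.
Proof.
move=> xz zy zx; apply: fproper_ltn_card.
have sub : itv z y `<=` itv x y.
  by move=> t /andP[zt ty]; rewrite /itv /= (le_trans xz zt).
rewrite finmap.fproperE; apply/andP; split; last apply/negP.
  by rewrite -fset_set_sub; try exact: itv_finite.
rewrite -fset_set_sub; try exact: itv_finite.
move=> /(_ x); rewrite /itv /= lexx (le_trans xz zy) => /(_ isT).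
by rewrite (negbTE zx).
Qed.

(* An element of M vanishes along equivalences, so only strictly increasing
   chains contribute to its powers. *)
Lemma offdiag_exp_eq0 m n x y :
  (itv_size x y <= n)%N -> (val m ^+ n) x y = 0.
Proof.
elim: n x => [|n IHn] x xyn.
  apply: inc_out; apply/negP => xy; move: xyn.
  rewrite leqn0 finmap.cardfs_eq0 => /eqP /fset_set_set0 -/(_ (itv_finite x y)).
  by move/seteqP => [+ _] => /(_ x); apply; rewrite /itv /= lexx.
rewrite exprS incME fsbig1// => z /andP[xz zy].
case: (boolP (z <= x)%O) => zx.
  by rewrite offdiagP ?mul0r // /eqv xz.
by rewrite IHn ?mulr0// -ltnS (leq_trans _ xyn)// itv_size_lt.
Qed.

(** The inverse is the geometric series in -m, whose value at each pair is a finite sum by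
    [offdiag_exp_eq0]. *)
Lemma unipotent_invertible m : invertible (1 + val m).
Proof.
pose n := - m; have -> : 1 + val m = 1 - val n by rewrite raddfN opprK.
pose u k := \sum_(i < k) val n ^+ i.
have uE k : (1 - val n) * u k = 1 - val n ^+ k.
  by rewrite -[1 - val n]opprB mulNr -subrX1 opprB.
have uC k : u k * (1 - val n) = (1 - val n) * u k.
  apply: commr_sym; apply: commr_sum => i _.
  apply/commrX/commr_sym/commrB; [exact: commr1 | exact: commr_refl].
(* The partial sum u k has a stationary value at (x, y) once k exceeds the
   length of the interval; w is the pointwise limit. *)
have u_stat x y k : (itv_size x y <= k)%N -> u k x y = u (itv_size x y) x y.
  move=> /subnKC <-; elim: (k - _)%N => [|j IHj]; first by rewrite addn0.
  rewrite addnS /u big_ord_recr incDE -/(u _) IHj offdiag_exp_eq0 ?addr0//.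
  exact: leq_addr.
have w_inc : (fun x y => u (itv_size x y) x y) \in @incident T R d X.
  by apply/asboolP => x y xy; rewrite inc_out.
pose w := IncAlgebra w_inc.
have u1 x y : (1 - val n ^+ itv_size x y) x y = (1 : K) x y.
  by rewrite incBE offdiag_exp_eq0 ?subr0.
(* At (x, y) the unit agrees with 1 - n^k for k the length of [x, y], and every value of [w]
   occurring in the product is taken on a subinterval, where it equals that of [u k]. *)
exists w; split; apply: incP => x y; rewrite incME -u1.
- rewrite -uE incME; apply: eq_fsbigr => z; rewrite inE => /andP[xz zy].
  congr (_ * _); rewrite [LHS]/=; symmetry; apply: u_stat; exact: itv_size_lel.
- rewrite -uE -uC incME; apply: eq_fsbigr => z; rewrite inE => /andP[xz zy].
  congr (_ * _); rewrite [LHS]/=; symmetry; apply: u_stat; exact: itv_size_ler.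
Qed.

(** * The subgroup of inner automorphisms defined by 1 + M *)

Lemma lpart_inv1 (v w : K) : v * w = 1 -> lpart v = 1 -> lpart w = 1.
Proof.
by move=> /(congr1 (@lpart T R d X)) + v1; rewrite lpartM v1 mul1r rmorph1.
Qed.

(** Membership of [v] in 1 + M becomes an equation on the ring morphism [lpart], which is stable
    under products and inverses. *)
Lemma In1E (phi : alg_aut K) :
  In1 R X phi <-> exists2 v, lpart v = 1 & inner_by v phi.
Proof.
split=> [[m mphi]|[v v1 vphi]].
  by exists (1 + val m); rewrite // lpartD lpart0 addr0 rmorph1.
by exists (mpart v); rewrite [v]lmpartE v1 in vphi.
Qed.

Lemma In1_subgroup : subgroup (In1 R X).
Proof.
split.
- by apply/In1E; exists 1; [exact: rmorph1 | exact: inner_by1].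
- move=> f g /In1E[u u1 uf] /In1E[v v1 vg]; apply/In1E; exists (v * u).
    by rewrite lpartM u1 v1 mulr1.
  exact: inner_byM.
- move=> f /In1E[v v1 vf]; have [w [vw wv _]] := vf; apply/In1E; exists w.
    exact: lpart_inv1 vw v1.
  exact: inner_byV vf.
Qed.

(** * Class idempotents and diagonal automorphisms *)

Lemma class_idem_eq x y : e x = e y <-> eqv x y.
Proof.
split=> [/(congr1 (fun a : L => val a y y))|xy].
  rewrite /= /class_idem_fun eqxx eqvxx /=; case: (eqv x y) => // /esym/eqP.
  by rewrite (negbTE (oner_neq0 _)).
apply/val_inj/incP => s t; rewrite /= /class_idem_fun; congr ((_ && _)%:R).
by apply/idP/idP; apply: eqv_trans; rewrite // eqvC.
Qed.

Lemma class_idem_sandwich x a y :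
  ~~ eqv x y -> val (e x) * val a * val (e y) = 0.
Proof.
move=> xy; apply: incP => s t; rewrite class_idemMr class_idemMl inc0E.
case: ifP => // yt; case: ifP => // xs; apply: diagP.
apply: contra xy => st; apply: eqv_trans xs (eqv_trans st _).
by rewrite eqvC.
Qed.

Lemma class_idemM x y : e x * e y = if eqv x y then e y else 0.
Proof.
apply/val_inj/incP => s t; rewrite rmorphM class_idemMl /= /class_idem_fun.
case: (boolP (eqv x y)) => xy; case: (boolP (eqv x s)) => xs //=.
- rewrite /class_idem_fun; case: eqVneq => //= <-.
  suff /negbTE -> : ~~ eqv y s by [].
  by apply: contra xs; exact: eqv_trans.
- case: eqVneq => //= <-; suff /negbTE -> : ~~ eqv y s by [].
  by apply: contra xy => ys; apply: eqv_trans xs _; rewrite eqvC.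
Qed.

Lemma LambdaE (phi : alg_aut K) :
  Lambda R X phi <-> forall a, phi (val a) = val (alpha phi a).
Proof.
split=> phiL a; first by rewrite [LHS]lmpartE [mpart _]phiL raddf0 addr0.
apply: val_inj; change (phi (val a) - val (alpha phi a) = 0).
by rewrite phiL subrr.
Qed.

Lemma In1I_Lambda : In1 R X `&` Lambda R X = [set 1%g].
Proof.
apply/seteqP; split=> [phi [/In1E[v v1 vphi] /LambdaE phiL]|_ ->]; last first.
  split; first by have [] := In1_subgroup.
  by apply/LambdaE => a; rewrite [LHS]/= alpha1.
suff vE : v = 1 by rewrite vE in vphi; exact: inner_by1_eq vphi.
(* Modulo M, conjugation by [v] is the identity on L; since [phi] preserves L, it fixes each [e x]
   exactly. *)
have phi_e x : phi (val (e x)) = val (e x).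
  have [w [vw wv phiE]] := vphi.
  have w1 := lpart_inv1 vw v1.
  by rewrite phiL /alpha phiE !lpartM w1 v1 mulr1 mul1r lpartK.
have ve x : v * val (e x) = val (e x) * v by rewrite -(inner_byVl _ vphi) phi_e.
rewrite [v]lmpartE v1 (_ : mpart v = 0) ?raddf0 ?addr0 //.
apply/val_inj/incP => x y; rewrite inc0E.
case: (boolP (eqv x y)) => xy; first by rewrite offdiagP.
(* At (x, y) with x, y inequivalent, v e_x vanishes whereas e_x v has the value v(x, y). *)
have /(congr1 (fun f : K => f x y)) := ve x.
rewrite class_idemMl class_idemMr eqvxx (negbTE xy) => vxy.
change (v x y - lpart_inc v x y = 0).
by rewrite /= (negbTE xy) subr0 -vxy.
Qed.

(** * Consequences of Condition (II) *)

Section ConditionII.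
Hypothesis hII : conditionII R X.
Implicit Types phi psi : alg_aut K.

Lemma alphaVK phi : cancel (alpha (phi^-1)%g) (alpha phi).
Proof. by move=> a; rewrite -(alphaM hII) mulgV alpha1. Qed.

(** The conjugate is defined by psi^-1(1 + m), which stays in 1 + M because Condition (II) makes
    automorphisms preserve M. *)
Lemma In1J phi psi : In1 R X phi -> In1 R X (phi ^ psi)%g.
Proof.
move=> [m mphi]; apply/In1E; exists ((psi^-1)%g (1 + val m)).
  by rewrite alg_aut_add rmorph1 lpartD rmorph1 (lpart_aut_offdiag hII) addr0.
exact: inner_byJ.
Qed.

Lemma Lambda_subgroup : subgroup (Lambda R X).
Proof.
split.
- by apply/LambdaE => a; rewrite [LHS]/= alpha1.
- move=> f g /LambdaE fL /LambdaE gL; apply/LambdaE => a.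
  by rewrite alg_autME gL fL (alphaM hII).
- move=> f /LambdaE fL; apply/LambdaE => a.
  (* Write a = alpha_f(a') with a' in L; then a = f(a'), so f^-1(a) = a' lies in L. *)
  by rewrite -{1}(alphaVK f a) -fL alg_autK.
Qed.

Lemma Ker_diag_autE phi : Ker_diag_aut hII phi <-> forall a, alpha phi a = a.
Proof.
split=> [phi1 a|phi1]; last exact: alg_autP.
by have := congr1 (fun u : alg_aut _ => u a) phi1.
Qed.

Lemma PsiE : Psi R X = Ker_diag_aut hII `&` Lambda R X.
Proof. by apply/seteqP; split=> phi [/Ker_diag_autE]. Qed.

(** For inequivalent s and t, choose x, y with phi(e_x) = e_s and phi(e_y) = e_t. Then phi(a)(s, t)
    is an entry of phi(e_x a e_y), and e_x a e_y = 0 for a in L. *)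
Lemma Lambda_class_idem phi :
  (forall x, exists y, phi (val (e x)) = val (e y)) -> Lambda R X phi.
Proof.
move=> phi_e a; apply/val_inj/incP => s t; rewrite inc0E.
case: (boolP (eqv s t)) => st; first by rewrite offdiagP.
change (phi (val a) s t - lpart_inc (phi (val a)) s t = 0).
rewrite /= (negbTE st) subr0.
(* [lpart_aut_class_idem] reaches [e z] only modulo M; the hypothesis on [phi] makes the equality
   exact. *)
have row z : exists x, phi (val (e x)) = val (e z).
  have [x ex] := lpart_aut_class_idem hII phi z; exists x.
  by have [y phix] := phi_e x; rewrite -ex phix lpartK.
have [[x xs] [y yt]] := (row s, row t).
have xy : ~~ eqv x y.
  apply: contra st => /class_idem_eq xy; apply/class_idem_eq/val_inj.
  by rewrite -xs xy.
have /(congr1 (fun f => phi f s t)) := class_idem_sandwich a xy.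
rewrite 2!alg_aut_mul xs yt class_idemMr class_idemMl !eqvxx => ->.
by rewrite raddf0.
Qed.

Lemma conjugator_exists phi : exists2 v : K, lpart v = 1 &
  forall x, v * phi (val (e x)) = val (alpha phi (e x)) * v.
Proof.
have [p pE] := choice (lpart_aut_class_idem hII phi).
have v_inc : (fun s t => phi (val (e (p s))) s t) \in @incident T R d X.
  by apply/asboolP => s t st; rewrite inc_out.
pose v := IncAlgebra v_inc; exists v.
  apply/val_inj/incP => s t; rewrite /= /inc1_fun.
  case: (boolP (eqv s t)) => st; last first.
    by case: eqVneq => // st'; rewrite st' eqvxx in st.
  have /(congr1 (fun a : L => val a s t)) := pE s.
  by rewrite /= /class_idem_fun st andbT.
move=> x; have [y [m phix]] := hII phi x.
have ax : alpha phi (e x) = e y.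
  by rewrite /alpha phix lpartD lpartK lpart0 addr0.
rewrite ax; apply: incP => s t; rewrite class_idemMl.
(* Row s of a product depends only on row s of its left factor, and there [v] coincides with
   [phi (e (p s))]. *)
transitivity ((phi (val (e (p s))) * phi (val (e x))) s t); first by [].
rewrite -alg_aut_mul -rmorphM class_idemM.
(* The induced automorphism of L sends e_(p s) to e_s and e_x to e_y. If p s and x were inequivalent
   while y ~ s, the orthogonality e_(p s) e_x = 0 would give e_y = 0. *)
have psx : eqv (p s) x = eqv y s.
  apply/idP/idP => [/class_idem_eq px|ys].
    by apply/class_idem_eq; rewrite -ax /alpha -px pE.
  apply/negPn/negP => px.
  have aps : alpha phi (e (p s)) = e s := pE s.
  have := alg_aut_mul (diag_aut hII phi) (e (p s)) (e x).
  rewrite /= ax aps !class_idemM (negbTE px) eqvC ys /alpha !raddf0 => /esym.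
  move=> /(congr1 (fun a : L => val a y y)).
  rewrite inc0E /= /class_idem_fun eqxx eqvxx => /eqP.
  by rewrite (negbTE (oner_neq0 _)).
rewrite psx; case: ifP => [|_]; last by rewrite !raddf0.
by rewrite -psx => /class_idem_eq <-.
Qed.

Lemma In1_Lambda phi : setprod (In1 R X) (Lambda R X) phi.
Proof.
have [v v1 vphi] := conjugator_exists phi.
have v_inv : invertible v by rewrite [v]lmpartE v1; exact: unipotent_invertible.
have [i vi] := inner_by_exists v_inv.
(* The second factor sends e_x to v phi(e_x) v^-1 = alpha(e_x), again a class idempotent. *)
exists i, (i^-1 * phi)%g; split; last by rewrite mulgA mulgV mul1g.
  by apply/In1E; exists v.
have [w [vw wv _]] := vi; have [u [_ uv iE]] := inner_byV vw wv vi.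
have uE : u = v by rewrite -[u]mulr1 -wv mulrA uv mul1r.
apply: Lambda_class_idem => x; have [y [m phix]] := hII phi x; exists y.
rewrite alg_autME iE uE vphi -mulrA vw mulr1.
by rewrite /alpha phix lpartD lpartK lpart0 addr0.
Qed.

(** * Subgroups defined through the diagonal part, and inclusions *)

Lemma diag_aut_subgroup (B : set (alg_aut L)) :
  subgroup B -> subgroup (diag_aut hII @^-1` B).
Proof. exact/preimage_subgroup/diag_autM. Qed.

Lemma Ker_diag_aut_subgroup : subgroup (Ker_diag_aut hII).
Proof.
apply: (@diag_aut_subgroup [set 1%g]).
by split=> [|_ _ -> ->|_ ->] //=; rewrite ?mulg1 ?invg1.
Qed.

Lemma Phi_subgroup : subgroup (Phi hII).
Proof. exact/diag_aut_subgroup/inner_aut_subgroup. Qed.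

Lemma Psi_subgroup : subgroup (Psi R X).
Proof.
rewrite PsiE; apply: subgroupI; first exact: Ker_diag_aut_subgroup.
exact: Lambda_subgroup.
Qed.

Lemma In1_sub_Ker : In1 R X `<=` Ker_diag_aut hII.
Proof.
move=> phi /In1E[v v1 [w [vw wv phiE]]]; apply/Ker_diag_autE => a.
have w1 := lpart_inv1 vw v1.
by rewrite /alpha phiE !lpartM w1 v1 mulr1 mul1r lpartK.
Qed.

(** As [lpart] is a ring morphism, conjugation by [v] induces conjugation by [lpart v] on L. *)
Lemma inner_sub_Phi : inner_aut K `<=` Phi hII.
Proof.
move=> phi [v [w [vw wv phiE]]]; exists (lpart v), (lpart w).
split=> [||a]; rewrite -?lpartM ?vw ?wv ?rmorph1 //.
by rewrite /= /alpha phiE !lpartM lpartK.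
Qed.

Lemma Ker_sub_Phi : Ker_diag_aut hII `<=` Phi hII.
Proof. by move=> phi phi1; exists 1; rewrite phi1; exact: inner_by1. Qed.

Lemma Psi_sub_Phi : Psi R X `<=` Phi hII.
Proof. by rewrite PsiE => phi [/Ker_sub_Phi]. Qed.

Lemma In1_sub_inner : In1 R X `<=` inner_aut K.
Proof. by move=> phi [m mphi]; exists (1 + val m). Qed.

(** * Inner automorphisms defined by units of L *)

Lemma In0_sub_Lambda : In0 R X `<=` Lambda R X.
Proof.
move=> phi [v [w [vw wv]] [w' [vw' w'v phiE]]]; apply/LambdaE => a.
(* The inverse supplied by [inner_by] is only known to lie in K; uniqueness of inverses places it in
   L. *)
have w'E : w' = val w.
  have /(congr1 val) := vw; rewrite rmorphM rmorph1 => vw1.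
  by rewrite -[w']mulr1 -vw1 mulrA w'v mul1r.
by rewrite /alpha phiE w'E -!rmorphM lpartK.
Qed.

(** If [v] defines an element of Lambda, dividing by conjugation by [lpart v] leaves an element of
    In1 and Lambda, which is trivial. As an intersection, In0 inherits the subgroup laws and
    stability under conjugation by Psi. *)
Lemma In0E : In0 R X = inner_aut K `&` Lambda R X.
Proof.
apply/seteqP; split=> [phi phi0|phi [[v vphi] phiL]].
  split; last exact: In0_sub_Lambda.
  by case: phi0 => v _ ?; exists (val v).
have [w [vw wv _]] := vphi.
have vw1 : lpart v * lpart w = 1 by rewrite -lpartM vw rmorph1.
have wv1 : lpart w * lpart v = 1 by rewrite -lpartM wv rmorph1.
have [vw1' wv1'] := (congr1 val vw1, congr1 val wv1).
rewrite !rmorphM rmorph1 in vw1' wv1'.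
have [j vj] : exists j, inner_by (val (lpart v)) j.
  by apply: inner_by_exists; exists (val (lpart w)).
have j0 : In0 R X j by exists (lpart v) => //; exists (lpart w).
suff : (In1 R X `&` Lambda R X) (phi * j^-1)%g.
  rewrite In1I_Lambda => /(congr1 (fun u => u * j)%g).
  by rewrite mulgVK mul1g => ->.
have [_ LM LV] := Lambda_subgroup; split; last first.
  by apply: LM => //; apply/LV/In0_sub_Lambda.
apply/In1E; exists (val (lpart w) * v); first by rewrite lpartM lpartK.
by apply: inner_byM => //; exact: inner_byV vj.
Qed.

Lemma In0_subgroup : subgroup (In0 R X).
Proof.
rewrite In0E; apply: subgroupI; last exact: Lambda_subgroup.
exact: inner_aut_subgroup.
Qed.

Lemma In0J phi psi : In0 R X phi -> Psi R X psi -> In0 R X (phi ^ psi)%g.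
Proof.
rewrite In0E PsiE => -[phi_in phiL] [_ psiL]; split; first exact: inner_autJ.
have [_ LM LV] := Lambda_subgroup; rewrite conjgE.
exact: LM (LV _ psiL) (LM _ _ phiL psiL).
Qed.

(** A unit of L defining alpha is also a unit of K; dividing [phi] by the conjugation it defines on
    K makes alpha trivial without leaving Lambda. *)
Lemma In0_Psi phi : Phi hII phi -> Lambda R X phi ->
  setprod (In0 R X) (Psi R X) phi.
Proof.
move=> [v valpha] phiL.
have [w [vw wv aE]] := valpha.
have [vw' wv'] := (congr1 val vw, congr1 val wv).
rewrite !rmorphM rmorph1 in vw' wv'.
have [j vj] : exists j, inner_by (val v) j.
  by apply: inner_by_exists; exists (val w).
have j0 : In0 R X j by exists v => //; exists w.
exists j, (j^-1 * phi)%g; split=> //; last by rewrite mulgA mulgV mul1g.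
have [_ LM LV] := Lambda_subgroup.
rewrite PsiE; split; last by apply: LM => //; exact/LV/In0_sub_Lambda.
apply/Ker_diag_autE => a; rewrite (alphaM hII).
have [u [_ uw jE]] := inner_byV vw' wv' vj.
have uE : u = val v by rewrite -[u]mulr1 -wv' mulrA uw mul1r.
have -> : alpha phi a = w * a * v by exact: aE.
rewrite /alpha jE uE -!rmorphM lpartK.
by rewrite !mulrA vw mul1r -mulrA vw mulr1.
Qed.

End ConditionII.

End IncidenceAlgebra.

Theorem theorem6p2 (T : comNzRingType) (R : algType T)
    (d : Order.disp_t) (X : locfinPreorderType d)
    (hII : conditionII R X) :
  [/\ semidirect_of [set: alg_aut (inc_algebra R X)] (In1 R X) (Lambda R X),
      semidirect_of (Ker_diag_aut hII) (In1 R X) (Psi R X)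
    & [/\ product_of (Phi hII) (inner_aut (inc_algebra R X)) (Psi R X),
          product_of (setprod (In0 R X) (Psi R X)) (In0 R X) (Psi R X)
        & semidirect_of (Phi hII) (In1 R X)
            (setprod (In0 R X) (Psi R X))]].
Proof.
have In1G := In1_subgroup R X; have LambdaG := Lambda_subgroup hII.
have PsiG := Psi_subgroup hII; have KerG := Ker_diag_aut_subgroup hII.
have PhiG := Phi_subgroup hII.
have In1N : forall B, In1 R X `<=` B -> normal_in (In1 R X) B.
  by move=> B sub; split=> // n p In1n _; exact: In1J.
have In1I H : subgroup H -> H `<=` Lambda R X -> In1 R X `&` H = [set 1%g].
  move=> [H1 _ _] HL; apply/seteqP; split=> [x [x1 /HL xL]|_ ->].
    by have : (In1 R X `&` Lambda R X) x by []; rewrite In1I_Lambda.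
  by split=> //; case: In1G.
(* Modular law: once [P] contains In1, the Lambda factor of an element of [P] lies in [P] as
   well. *)
have In1_cancel (P : set (alg_aut (inc_algebra R X))) i l :
    subgroup P -> In1 R X `<=` P -> In1 R X i -> P (i * l)%g -> P l.
  move=> [_ PM PV] sub i1 Pil; rewrite -[l](mulKg i).
  by apply: PM => //; exact/PV/sub.
have In1Phi : In1 R X `<=` Phi hII.
  by move=> i /(In1_sub_Ker hII); exact: Ker_sub_Phi.
have In0PsiG : subgroup (setprod (In0 R X) (Psi R X)).
  by apply: setprod_subgroup => //; [exact: In0_subgroup | exact: In0J].
have In0PsiL : setprod (In0 R X) (Psi R X) `<=` Lambda R X.
  apply: setprod_sub => // [|phi []//]; exact: In0_sub_Lambda.
have In0Phi : In0 R X `<=` Phi hII.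
  by rewrite (In0E hII) => phi [/(@inner_sub_Phi _ _ _ _ hII)].
(* The modular law puts the Lambda factor in Phi, and [In0_Psi] then splits it. *)
have PhiE : Phi hII = setprod (In1 R X) (setprod (In0 R X) (Psi R X)).
  apply/seteqP; split=> [phi|]; last first.
    apply: setprod_sub => //; apply: setprod_sub => //; exact: Psi_sub_Phi.
  have [i [l [i1 lL ->]]] := In1_Lambda hII phi => Pil.
  exists i, l; split=> //; apply: In0_Psi => //.
  exact: In1_cancel i1 Pil.
split.
- split; last exact: In1I_Lambda.
  split=> //; first exact: In1N.
  by apply/esym/seteqP; split=> // phi _; exact: In1_Lambda.
- split; last by apply: In1I => // phi [].
  split=> //; first by apply: In1N; exact: In1_sub_Ker.
  apply/seteqP; split=> [phi|]; last first.
    apply: setprod_sub => //; first exact: In1_sub_Ker.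
    by rewrite (PsiE hII) => ? [].
  have [i [l [i1 lL ->]]] := In1_Lambda hII phi => Kil.
  exists i, l; split=> //; rewrite (PsiE hII); split=> //.
  by apply: In1_cancel i1 Kil => //; exact: In1_sub_Ker.
- split.
  + split=> //.
    * exact: inner_aut_subgroup.
    * by split=> [|n p n_in _]; [exact: inner_sub_Phi | exact: inner_autJ].
    * apply/seteqP; split; last first.
        by apply: setprod_sub; [|exact: inner_sub_Phi|exact: Psi_sub_Phi].
      (* Regroup In1 (In0 Psi) as (In1 In0) Psi; the first two factors are both inner. *)
      rewrite PhiE => _ [i [_ [i1 [j [p [j0 p_Psi ->]]] ->]]].
      exists (i * j)%g, p; split; rewrite ?mulgA //.
      have [_ innerM _] := inner_aut_subgroup (inc_algebra R X); apply: innerM.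
        exact: In1_sub_inner.
      by move: j0; rewrite (In0E hII) => -[].
  + have In0G := In0_subgroup hII.
    by split=> //; apply: normal_in_setprod => // n h; exact: In0J.
  + split; last exact: In1I.
    by split=> //; exact: In1N.
Qed.
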